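(* Let $E(x)$ denote the largest integer $k\ge 0$ such that there exist $k$ consecutive positive integers $m, m+1,\dots,m+k-1$, all not exceeding $x$, each of which is abundant. Define $$\varpi=\inf_{M\ge 1}\left(\prod_{i=1}^{M}\max\left\{\frac{2\,(i,M)}{\sigma((i,M))},\,1\right\}\right)^{1/M},$$ where the infimum is over all positive integers $M$. Then $$\lim_{x\to\infty}\frac{E(x)}{\log\log\log x}=\left(\log\varpi\right)^{-1}.$$
   Context: $\sigma(n)$ denotes the sum of all positive divisors of $n$. A positive integer $n$ is called abundant if $\sigma(n)\ge 2n$ (so perfect numbers count as abundant). $(a,b)$ denotes the greatest common divisor of integers $a$ and $b$. $\log$ is the natural logarithm. *)

(* Defs.v *)
From mathcomp Require Import all_boot all_order all_algebra.
From mathcomp Require Import all_classical all_reals all_analysis.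

Set Implicit Arguments.
Unset Strict Implicit.
Unset Printing Implicit Defensive.

Import Order.TTheory GRing.Theory Num.Theory.

Local Open Scope classical_set_scope.
Local Open Scope ring_scope.

Definition sigma (n : nat) : nat := (\sum_(d <- divisors n) d)%N.

(* Non-strict: perfect numbers are abundant here. *)
Definition abundant (n : nat) : bool := ((0 < n) && (2 * n <= sigma n))%N.

Definition abundant_run (R : realType) (x : R) (k : nat) : Prop :=
  exists2 m : nat, (0 < m)%N &
    forall j : nat, (j < k)%N -> abundant (m + j) /\ (m + j)%:R <= x.

(* The bound k <= x on the search range loses nothing, since m >= 1; the
   characterization of E as the largest such k is E_largest below. *)
Definition E (R : realType) (x : R) : nat :=
  (\max_(k < (Num.truncn x).+1 | `[< abundant_run x k >]) k)%N.

Lemma E_largest (R : realType) (x : R) :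
  abundant_run x (E x) /\ forall k : nat, abundant_run x k -> (k <= E x)%N.
Proof.
have run0 : abundant_run x 0 by exists 1%N.
split.
  rewrite /E; elim/big_ind: _ => //.
    by move=> a b ra rb; rewrite /= /maxn; case: ifP.
  by move=> i /asboolP.
case=> [//|k] rk; case: (rk) => m m0 /(_ k (ltnSn k)) [_ le_x].
have k_lt : (k.+1 < (Num.truncn x).+1)%N.
  have le_k : k.+1%:R <= x.
    by apply: le_trans le_x; rewrite ler_nat -addn1 addnC leq_add2r.
  have x0 : 0 <= x by apply: le_trans le_k.
  by rewrite ltnS truncn_ge_nat.
exact: (@leq_bigmax_cond _ _ (fun i : 'I__ => i : nat) (Ordinal k_lt)
  (introT (asboolP _) rk)).
Qed.

Definition varpi (R : realType) : R :=
  inf [set (\prod_(1 <= i < M.+1)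
              Num.max (2 * (gcdn i M)%:R / (sigma (gcdn i M))%:R) 1)
             `^ (M%:R^-1) | M in [set M : nat | (0 < M)%N]].

(* Main.v *)
Require Import Defs.
From mathcomp Require Import all_boot all_order all_algebra.
From mathcomp Require Import all_classical all_reals all_analysis.
From mathcomp Require Import ring lra zify.
Import Order.TTheory GRing.Theory Num.Theory.
Import numFieldNormedType.Exports.
Local Open Scope classical_set_scope.
Local Open Scope ring_scope.

(** Fix M and write D(n) for the logarithm of max(2 / h((n, M)), 1), where
    h(n) = sigma(n) / n.  The function D is M-periodic, and the logarithm of
    varpi is the infimum over M of the mean of D over a period.  It is positive
    because the mean of h((n, M)) is at most the sum of the 1/d^2, which is
    smaller than 2.

    Upper bound: if n is abundant, then D(n) is at most the logarithm of
    h(n / (n, M)), hence at most the sum of 1/(p - 1) over the primes p dividing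
    n / (n, M).  When M = (y^2)!, each such p has a power exceeding y^2 that
    divides n.  Summing over a run of length k, a prime contributes about
    k / p^a times, which costs O(k / y) in total, plus possibly once more.  The
    latter contributions add up to the sum of 1/(p - 1) over the primes dividing
    the product of the run, which is (1 + o(1)) times the triple logarithm of x
    by an upper bound of Mertens type.

    Lower bound: take M nearly optimal, cut the primes above a large y into
    consecutive blocks such that the sum of log(1 + 1/p) over the i-th block
    barely exceeds D(i), and use the Chinese remainder theorem to find m divisible
    by M such that the i-th block divides m + i.  Then the m + i are abundant, and
    the divergence of the sum of 1/p controls the size of the largest prime. *)

(** * The abundancy index h(n) = sigma(n) / n and its multiplicative bounds *)

Section Abundancy.
Set Implicit Arguments.
Unset Strict Implicit.
Variable R : realType.

Lemma ler_sum_subset (s t : seq nat) (f : nat -> R) :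
  (forall i, 0 <= f i) -> uniq s -> {subset s <= t} ->
  \sum_(i <- s) f i <= \sum_(i <- t) f i.
Proof.
move=> f0; elim: s t => [|x s IH] t /=.
  by move=> _ _; rewrite big_nil sumr_ge0.
move=> /andP[xs us] sub.
have xt : x \in t by apply: sub; rewrite mem_head.
rewrite big_cons (perm_big _ (perm_to_rem xt)) big_cons lerD2l.
apply: IH => // y ys; have : y \in t by apply: sub; rewrite in_cons ys orbT.
rewrite (perm_mem (perm_to_rem xt)) in_cons => /predU1P[yx|//].
by rewrite -yx ys in xs.
Qed.

(** As a sum of reciprocals of divisors, abundancies can be compared by inclusions between lists of
    divisors. *)
Definition abundancy (n : nat) : R := \sum_(d <- divisors n) d%:R^-1.
Local Notation h := abundancy.

Lemma abundancy_sigma n : (0 < n)%N -> h n = (sigma n)%:R / n%:R.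
Proof.
move=> n0; rewrite /abundancy /sigma natr_sum mulr_suml.
have P : perm_eq (divisors n) [seq n %/ d | d <- divisors n]%N.
  have inv d : d \in divisors n -> (n %/ (n %/ d) = d)%N.
    by rewrite -dvdn_divisors// => dn; rewrite divnA // mulnC mulnK //.
  apply: uniq_perm; rewrite ?divisors_uniq//.
    rewrite map_inj_in_uniq ?divisors_uniq// => a b /inv {2}<- /inv {2}<- -> //.
  move=> d; apply/idP/mapP => [dn|[e en ->]].
    exists (n %/ d)%N; last by rewrite inv.
    by move: dn; rewrite -!dvdn_divisors//; exact: dvdn_div.
  by move: en; rewrite -!dvdn_divisors//; exact: dvdn_div.
rewrite (perm_big _ P) big_map big_seq [RHS]big_seq; apply: eq_bigr => d.
rewrite -dvdn_divisors// => dn.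
have d0 : d%:R != 0 :> R by rewrite pnatr_eq0 -lt0n (dvdn_gt0 n0).
by rewrite natf_div// invf_div.
Qed.

Lemma abundancy_ge1 n : (0 < n)%N -> 1 <= h n.
Proof.
move=> n0.
rewrite -[leLHS](_ : \sum_(d <- [:: 1%N]) d%:R^-1 = 1); last by rewrite big_seq1 invr1.
by apply: ler_sum_subset => // d; rewrite inE => /eqP ->; rewrite -dvdn_divisors.
Qed.

Lemma abundancy_gt0 n : (0 < n)%N -> 0 < h n.
Proof. by move=> /abundancy_ge1; apply: lt_le_trans. Qed.

Lemma abundantE n : (0 < n)%N -> abundant n = (2 <= h n).
Proof.
move=> n0; rewrite /abundant n0/= abundancy_sigma// ler_pdivlMr ?ltr0n//.
by rewrite -natrM ler_nat.
Qed.

Lemma abundancy_dvd d n : (0 < n)%N -> (d %| n)%N -> h d <= h n.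
Proof.
move=> n0 dn; apply: ler_sum_subset => //; first exact: divisors_uniq.
by move=> e; rewrite -!dvdn_divisors ?(dvdn_gt0 n0)// => /dvdn_trans; apply.
Qed.

(** The divisors of [g] and their multiples by [p] form disjoint sets of divisors of [p * g]. *)
Lemma abundancy_prime_mul p g : prime p -> (0 < g)%N -> ~~ (p %| g)%N ->
  (1 + p%:R^-1) * h g <= h (p * g).
Proof.
move=> pp g0 pg; have p0 := prime_gt0 pp.
rewrite mulrDl mul1r mulr_sumr.
rewrite (_ : \sum_(d <- divisors g) p%:R^-1 * d%:R^-1 =
  \sum_(d <- [seq p * d | d <- divisors g]%N) d%:R^-1); last first.
  by rewrite big_map; apply: eq_bigr => d _; rewrite natrM invfM.
rewrite -big_cat; apply: ler_sum_subset => //.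
  rewrite cat_uniq divisors_uniq map_inj_uniq ?divisors_uniq ?andbT/=.
    apply/hasPn => d /mapP[e _ ->]; rewrite /= -dvdn_divisors//.
    by apply: contra pg; apply: dvdn_trans; rewrite dvdn_mulr.
  by move=> a b /eqP; rewrite eqn_pmul2l// => /eqP.
move=> d; rewrite mem_cat -!dvdn_divisors ?muln_gt0 ?p0//.
case/orP=> [dg|/mapP[e]]; first by rewrite dvdn_mull.
by rewrite -dvdn_divisors// => eg ->; rewrite dvdn_pmul2l.
Qed.

(** Every divisor [d] of [a * b] splits as (d, a) times d / (d, a), and the second factor divides
    [b]. *)
Lemma abundancy_mul a b : (0 < a)%N -> (0 < b)%N -> h (a * b) <= h a * h b.
Proof.
move=> a0 b0.
have -> : h a * h b =
    \sum_(d <- [seq x * y | x <- divisors a, y <- divisors b]%N) d%:R^-1.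
  rewrite big_flatten big_map mulr_suml; apply: eq_bigr => x _.
  by rewrite mulr_sumr big_map; apply: eq_bigr => y _; rewrite natrM invfM.
apply: ler_sum_subset => //; first exact: divisors_uniq.
move=> d; rewrite -dvdn_divisors ?muln_gt0 ?a0// => dab.
have d0 : (0 < d)%N by apply: dvdn_gt0 dab; rewrite muln_gt0 a0.
have g0 : (0 < gcdn d a)%N by rewrite gcdn_gt0 d0.
apply/allpairsP; exists (gcdn d a, d %/ gcdn d a)%N; split => /=.
- by rewrite -dvdn_divisors// dvdn_gcdr.
- rewrite -dvdn_divisors// -(@Gauss_dvdr _ (a %/ gcdn d a)).
    by rewrite -(@dvdn_pmul2l (gcdn d a))// mulnA ![(gcdn d a * _)%N]mulnC !divnK ?dvdn_gcdr ?dvdn_gcdl.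
  rewrite /coprime -(@eqn_pmul2l (gcdn d a))// muln1 muln_gcdr.
  by rewrite ![(gcdn d a * _)%N]mulnC !divnK ?dvdn_gcdr ?dvdn_gcdl.
- by rewrite mulnC divnK// dvdn_gcdl.
Qed.

Lemma abundancy_pfactor p a : prime p -> h (p ^ a) <= 1 + (p.-1%:R)^-1.
Proof.
move=> pp; have p1 := prime_gt1 pp.
have p1' : 0 < p.-1%:R :> R by rewrite ltr0n; lia.
have pE : p%:R = p.-1%:R + 1 :> R by rewrite natr1 prednK// ltnW.
apply: (@le_trans _ _ (\sum_(d <- [seq p ^ i | i <- iota 0 a.+1]%N) d%:R^-1)).
  apply: ler_sum_subset => //; first exact: divisors_uniq.
  move=> d; rewrite -dvdn_divisors ?expn_gt0 ?prime_gt0//.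
  move=> /(dvdn_pfactor _ _ pp)[i ia ->]; apply/mapP; exists i => //.
  by rewrite mem_iota add0n ltnS.
(* The subtracted term gives the exact value of the geometric sum, so that the induction on [a] goes
   through. *)
rewrite big_map; apply: (@le_trans _ _ (1 + p.-1%:R^-1 - p.-1%:R^-1 / (p ^ a)%:R)); last first.
  by rewrite lerBlDr lerDl divr_ge0// invr_ge0 ltW.
elim: a => [|a IH]; first by rewrite big_seq1 expn0 invr1; lra.
rewrite -[a.+2]addn1 iotaD big_cat/= big_seq1 add0n.
apply: (le_trans (lerD IH (lexx _))).
rewrite !expnS natrM pE.
have := @expn_gt0 p a; rewrite (ltnW p1)/= -(ltr0n R).
move: (p ^ a)%:R p.-1%:R p1' => x q q0 x0.
have q1 : 0 < q + 1 by lra.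
rewrite le_eqVlt; apply/orP; left; apply/eqP; field.
by rewrite !gt_eqF.
Qed.

(** Strong induction, splitting off the full power of the least prime factor: submultiplicativity
    and ln(1 + t) <= t give one term 1/(p - 1) per prime. *)
Lemma ln_abundancy_le n : (0 < n)%N ->
  ln (h n) <= \sum_(p <- primes n) (p.-1%:R)^-1.
Proof.
elim/ltn_ind: n => n IH n0.
have [n1|n1] := leqP n 1.
  have -> : n = 1%N by lia.
  by rewrite big_nil /abundancy big_seq1 invr1 ln1.
have pp := pdiv_prime n1; set p := pdiv n in pp.
have [m pm nE] := pfactor_coprime pp n0.
have a0 : (0 < logn p n)%N by rewrite logn_gt0 mem_primes pp n0 pdiv_dvd.
have pa0 : (0 < p ^ logn p n)%N by rewrite expn_gt0 prime_gt0.
have m0 : (0 < m)%N by move: n0; rewrite nE muln_gt0 => /andP[].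
have mn : (m < n)%N.
  rewrite [ltnRHS]nE ltn_Pmulr// -(expn0 p) ltn_exp2l ?prime_gt1//.
have hm := abundancy_gt0 m0; have hp := abundancy_gt0 pa0.
have P : perm_eq (primes n) (p :: primes m).
  apply: uniq_perm; rewrite ?primes_uniq//=.
    by rewrite primes_uniq andbT mem_primes pp m0/= -prime_coprime.
  move=> q; rewrite (congr1 (fun x => q \in primes x) nE) primesM// primesX//.
  by rewrite [RHS]in_cons (primes_prime pp) mem_seq1 orbC.
rewrite (perm_big _ P) big_cons.
apply: (@le_trans _ _ (ln (h (p ^ logn p n)) + ln (h m))).
  rewrite -lnM ?posrE// ler_ln ?posrE ?mulr_gt0 ?abundancy_gt0//.
  by rewrite {1}nE mulnC abundancy_mul.
apply: lerD; last exact: IH.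
apply: (@le_trans _ _ (ln (1 + p.-1%:R^-1))).
  by rewrite ler_ln ?posrE ?abundancy_pfactor// ltr_pwDl// invr_ge0.
apply: le_ln1Dx.
by rewrite (@lt_le_trans _ _ 0)// invr_ge0.
Qed.

End Abundancy.

(** * The periodic defect, its mean over a period, and the positivity of log [varpi] *)

Section Defect.
Set Implicit Arguments.
Unset Strict Implicit.
Variable R : realType.
Local Notation h := (@abundancy R).
Local Notation L := (ln (varpi R)).

Definition defect (M n : nat) : R :=
  ln (Num.max (2 * (gcdn n M)%:R / (sigma (gcdn n M))%:R) 1).

Lemma defect_ge0 M n : 0 <= defect M n.
Proof. by apply: ln_ge0; rewrite le_max lexx orbT. Qed.

Lemma expR_defect M n : (0 < M)%N ->
  expR (defect M n) = Num.max (2 / h (gcdn n M)) 1.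
Proof.
move=> M0; have g0 : (0 < gcdn n M)%N by rewrite gcdn_gt0 M0 orbT.
rewrite /defect lnK; last by rewrite posrE lt_max ltr01 orbT.
by rewrite abundancy_sigma// invf_div mulrA.
Qed.

Lemma defect_addl M m n : (M %| m)%N -> defect M (m + n) = defect M n.
Proof.
by move=> /dvdnP[q ->]; rewrite /defect -gcdn_modl modnMDl gcdn_modl.
Qed.

(** Submultiplicativity gives 2 <= h((n, M)) h(n / (n, M)): the cofactor must make up for what the
    gcd lacks. *)
Lemma abundant_defect M n : (0 < M)%N -> abundant n ->
  defect M n <= ln (h (n %/ gcdn n M)).
Proof.
move=> M0 an; have n0 : (0 < n)%N by case/andP: an.
have g0 : (0 < gcdn n M)%N by rewrite gcdn_gt0 M0 orbT.
have q0 : (0 < n %/ gcdn n M)%N by rewrite divn_gt0// dvdn_leq// dvdn_gcdl.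
rewrite -ler_expR lnK ?posrE ?abundancy_gt0// expR_defect// ge_max abundancy_ge1// andbT.
rewrite ler_pdivrMr ?abundancy_gt0// mulrC.
apply: le_trans (abundancy_mul _ g0 q0).
by rewrite mulnC divnK ?dvdn_gcdl// -abundantE.
Qed.

Lemma defect_abundant M n (s : seq nat) : (0 < M)%N -> (0 < n)%N ->
  all prime s -> uniq s -> (forall p, p \in s -> ~~ (p %| M)%N /\ (p %| n)%N) ->
  defect M n <= \sum_(p <- s) ln (1 + p%:R^-1) -> abundant n.
Proof.
move=> M0 n0 ps us sn le_s; have g0 : (0 < gcdn n M)%N by rewrite gcdn_gt0 M0 orbT.
(* The divisor [d] starts as the gcd and gains the primes of [s] one by one; keeping track of its
   prime factors shows that each new prime does not yet divide it. *)
have [d [dn d0 /allP ds hd]] : exists d, [/\ (d %| n)%N, (0 < d)%N,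
    all (fun p => (p \in s) || (p %| M)%N) (primes d) &
    expR (\sum_(p <- s) ln (1 + p%:R^-1)) * h (gcdn n M) <= h d].
  elim: s ps us sn {le_s} => [|p s IH] /=.
    move=> _ _ _; exists (gcdn n M); split; rewrite ?dvdn_gcdl//.
      apply/allP => p; rewrite mem_primes => /and3P[_ _ /dvdn_trans->];
        by rewrite ?dvdn_gcdr// orbT.
    by rewrite big_nil expR0 mul1r.
  move=> /andP[pp ps] /andP[pns us] sn.
  have [|d [dn d0 /allP ds hd]] := IH ps us.
    by move=> q qs; apply: sn; rewrite in_cons qs orbT.
  have [pM pn] := sn p (mem_head _ _).
  have pd : ~~ (p %| d)%N.
    apply/negP => pd; have : p \in primes d by rewrite mem_primes pp d0.
    by move/ds; rewrite (negPf pns) (negPf pM).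
  exists (p * d)%N; split.
  - by rewrite Gauss_dvd ?pn// prime_coprime.
  - by rewrite muln_gt0 d0 prime_gt0.
  - apply/allP => q; rewrite primesM ?(prime_gt0 pp)// primes_prime// mem_seq1 in_cons.
    by case/orP => [->//|/ds /orP[->|->]]; rewrite !orbT.
  - apply: le_trans (abundancy_prime_mul _ pp d0 pd).
    have p1 : 0 < 1 + p%:R^-1 :> R by rewrite ltr_pwDl// invr_ge0.
    by rewrite big_cons expRD lnK ?posrE// -mulrA ler_pM2l.
rewrite (@abundantE R)//; apply: le_trans (abundancy_dvd R n0 dn).
apply: le_trans hd; rewrite -ler_pdivrMr ?abundancy_gt0//.
rewrite -ler_expR in le_s; apply: le_trans le_s.
by rewrite expR_defect// le_max lexx.
Qed.

Definition total_defect M : R := \sum_(1 <= i < M.+1) defect M i.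

Lemma sum_defect_period M m q :
  \sum_(m <= i < m + q * M) defect M i = q%:R * total_defect M.
Proof.
have one k : \sum_(k <= i < k + M) defect M i = total_defect M.
  (* Sliding the window by one exchanges two terms at distance [M], equal by periodicity. *)
  have sh j : \sum_(j <= i < j + M) defect M i = \sum_(j.+1 <= i < j.+1 + M) defect M i.
    case: M => [|M]; first by rewrite !addn0 !big_geq.
    rewrite big_ltn ?addnS ?ltnS ?leq_addr// addrC addSn.
    rewrite [RHS]big_nat_recr/= ?leq_addr ?ltnS ?leq_addr//; congr (_ + _).
    by rewrite -addnS addnC defect_addl ?dvdnn.
  rewrite /total_defect -[M.+1]add1n.
  elim: k => [|k IH]; first by rewrite sh.
  by rewrite -sh.
elim: q => [|q IH]; first by rewrite mul0r mul0n addn0 big_geq.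
rewrite mulSn addnCA addnC (@big_cat_nat _ _ _ (m + q * M))/= ?leq_addr//.
by rewrite IH one -natr1 mulrDl mul1r.
Qed.

(** The whole periods inside the window give the bound; the fewer than [M] remaining terms are
    nonnegative. *)
Lemma sum_defect_ge M m k (L : R) : (0 < M)%N -> 0 <= L -> M%:R * L <= total_defect M ->
  (k%:R - M%:R) * L <= \sum_(m <= i < m + k) defect M i.
Proof.
move=> M0 L0 LM; have le1 : (k %/ M * M <= k)%N by exact: leq_trunc_div.
apply: (@le_trans _ _ (\sum_(m <= i < m + (k %/ M) * M) defect M i)); last first.
  rewrite [leRHS](@big_cat_nat _ _ _ (m + (k %/ M) * M)) ?leq_addr ?leq_add2l//=.
  by rewrite lerDl sumr_ge0// => i _; exact: defect_ge0.
rewrite sum_defect_period; apply: le_trans (ler_wpM2l (ler0n _ _) LM).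
rewrite mulrA -natrM; apply: ler_wpM2r => //.
rewrite lerBlDr -natrD ler_nat {1}(divn_eq k M) leq_add2l ltnW// ltn_mod//.
Qed.

Lemma sum_defect_le M m k (L : R) : (0 < M)%N -> 0 <= L -> total_defect M <= M%:R * L ->
  \sum_(m <= i < m + k) defect M i <= (k%:R + M%:R) * L.
Proof.
move=> M0 L0 LM.
have le1 : (k <= (k %/ M).+1 * M)%N by rewrite ltnW// ltn_ceil.
apply: (@le_trans _ _ (\sum_(m <= i < m + (k %/ M).+1 * M) defect M i)).
  rewrite [leRHS](@big_cat_nat _ _ _ (m + k)) ?leq_addr ?leq_add2l//=.
  by rewrite lerDl sumr_ge0// => i _; exact: defect_ge0.
rewrite sum_defect_period; apply: (le_trans (ler_wpM2l (ler0n _ _) LM)).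
rewrite mulrA -natrM; apply: ler_wpM2r => //.
rewrite -natrD ler_nat mulSn addnC leq_add2r leq_trunc_div//.
Qed.

(** Telescoping from the third term on, with 7/4 = 1 + 1/4 + 1/2. What matters is that the constant
    is below 2. *)
Lemma sum_inv_sqr_le N : \sum_(1 <= d < N.+1) (d%:R ^+ 2)^-1 <= 7 / 4 :> R.
Proof.
have H k : \sum_(1 <= d < k.+3) (d%:R ^+ 2)^-1 <= 7 / 4 - (k.+2%:R)^-1 :> R.
  elim: k => [|k IH].
    by rewrite big_nat_recr//= big_nat1; lra.
  rewrite big_nat_recr//=; apply: (le_trans (lerD IH (lexx _))).
  have x0 : 0 < k.+2%:R :> R by rewrite ltr0n.
  rewrite -[k.+3]addn1 natrD; move: k.+2%:R x0 => x x0.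
  rewrite -subr_ge0.
  have -> : 7 / 4 - (x + 1)^-1 - (7 / 4 - x^-1 + ((x + 1) ^+ 2)^-1) =
     (x * (x + 1) ^+ 2)^-1.
    by field; rewrite !gt_eqF//; lra.
  by rewrite invr_ge0 mulr_ge0 ?ltW// exprn_gt0// addr_gt0.
case: N => [|[|k]]; first by rewrite big_geq//; lra.
  by rewrite big_nat1 expr1n invr1; lra.
apply: le_trans (H k) _; rewrite lerBlDr lerDl invr_ge0 //.
Qed.

(** After exchanging sums, a divisor [d] of [M] divides M / d of the integers up to [M] and so
    contributes M / d^2. *)
Lemma sum_abundancy_gcd_le M : (0 < M)%N ->
  \sum_(1 <= i < M.+1) h (gcdn i M) <= 7 / 4 * M%:R.
Proof.
move=> M0.
have hE i : h (gcdn i M) = \sum_(d <- divisors M) (if (d %| i)%N then d%:R^-1 else 0).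
  rewrite -big_mkcond -big_filter; apply: perm_big; apply: uniq_perm.
  - exact: divisors_uniq.
  - by rewrite filter_uniq ?divisors_uniq.
  by move=> d; rewrite mem_filter -!dvdn_divisors ?gcdn_gt0 ?M0 ?orbT// dvdn_gcd.
under eq_bigr do rewrite hE.
rewrite exchange_big/= (@le_trans _ _ (\sum_(d <- divisors M) M%:R * (d%:R ^+ 2)^-1))//.
  rewrite !big_seq; apply: ler_sum => d; rewrite -dvdn_divisors// => dM.
  have d0 : (0 < d)%N by apply: dvdn_gt0 dM.
  have -> : \sum_(1 <= i < M.+1) (if (d %| i)%N then d%:R^-1 else 0) =
      (\sum_(1 <= i < M.+1) (d %| i))%N%:R * d%:R^-1 :> R.
    by rewrite natr_sum mulr_suml; apply: eq_bigr => i _; case: ifP; rewrite ?mul1r ?mul0r.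
  by rewrite -divn_count_dvd natf_div// -?lt0n// expr2 invfM mulrA.
rewrite -mulr_sumr mulrC ler_wpM2r//; apply: le_trans (sum_inv_sqr_le M).
apply: ler_sum_subset; first by move=> i; rewrite invr_ge0 exprn_ge0.
  exact: divisors_uniq.
move=> d; rewrite -dvdn_divisors// => dM; rewrite mem_index_iota ltnS (dvdn_leq M0 dM) andbT.
exact: dvdn_gt0 dM.
Qed.

(** The constant 8/7 is 2 divided by the bound 7/4 on the mean of h((i, M)). *)
Lemma total_defect_ge M : (0 < M)%N -> M%:R * ln (8 / 7) <= total_defect M.
Proof.
move=> M0; have c0 : 0 < 7 / 4 :> R by lra.
(* Bounding [ln] by its tangent at [7 / 4] plays the role of Jensen's inequality. *)
have step i : ln (8 / 7) + 1 - h (gcdn i M) / (7 / 4) <= defect M i.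
  have g0 : (0 < gcdn i M)%N by rewrite gcdn_gt0 M0 orbT.
  have hg := abundancy_gt0 R g0.
  apply: (@le_trans _ _ (ln (2 / h (gcdn i M)))); last first.
    rewrite -ler_expR expR_defect// lnK ?posrE ?divr_gt0//.
    by rewrite le_max lexx.
  have -> : 2 / h (gcdn i M) = 8 / 7 / (h (gcdn i M) / (7 / 4)).
    by field; rewrite gt_eqF.
  set u := h (gcdn i M) / (7 / 4); have u0 : 0 < u by rewrite divr_gt0.
  have e0 : 0 < 8 / 7 :> R by lra.
  rewrite (@ln_div _ (8 / 7)) ?posrE//.
  have : ln (1 + (u - 1)) <= u - 1 by apply: le_ln1Dx; lra.
  rewrite addrC subrK; lra.
apply: (@le_trans _ _ (\sum_(1 <= i < M.+1) (ln (8 / 7) + 1 - h (gcdn i M) / (7 / 4)))); last first.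
  by apply: ler_sum_nat => i _.
rewrite sumrB -mulr_suml sumr_const_nat subSS subn0 -(mulr_natl (_ + _)) [X in _ <= X - _]mulrDr mulr1.
rewrite -addrA lerDl subr_ge0 ler_pdivrMr// mulrC; exact: sum_abundancy_gcd_le.
Qed.

Lemma varpi_termE M : (0 < M)%N ->
  (\prod_(1 <= i < M.+1)
     Num.max (2 * (gcdn i M)%:R / (sigma (gcdn i M))%:R) 1) `^ (M%:R^-1) =
  expR (total_defect M / M%:R).
Proof.
move=> M0; rewrite mulrC.
have -> : \prod_(1 <= i < M.+1)
     Num.max (2 * (gcdn i M)%:R / (sigma (gcdn i M))%:R) 1 = expR (total_defect M).
  rewrite /total_defect expR_sum; apply: eq_bigr => i _.
  by rewrite /defect lnK// posrE lt_max ltr01 orbT.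
by rewrite -expRM mulrC.
Qed.

Lemma varpi_ge : 8 / 7 <= varpi R.
Proof.
apply: lb_le_inf.
  by eexists; exists 1%N => //; reflexivity.
move=> _ [M /= M0 <-]; rewrite varpi_termE//.
rewrite -[leLHS]lnK ?posrE; last by lra.
by rewrite ler_expR ler_pdivlMr ?ltr0n// mulrC total_defect_ge.
Qed.

Lemma ln_varpi_gt0 : 0 < L.
Proof. by apply: ln_gt0; have := varpi_ge; lra. Qed.

Lemma total_defect_ge_ln_varpi M : (0 < M)%N -> M%:R * L <= total_defect M.
Proof.
move=> M0; rewrite mulrC -ler_pdivlMr ?ltr0n// -ler_expR -varpi_termE// lnK; last first.
  by rewrite posrE; have := varpi_ge; lra.
apply: ge_inf; last by exists M.
by exists 0 => _ [N /= N0 <-]; exact: powR_ge0.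
Qed.

Lemma total_defect_near_ln_varpi (e : R) : 0 < e ->
  exists2 M, (0 < M)%N & total_defect M <= M%:R * (L + e).
Proof.
move=> e0; have v0 : 0 < varpi R by have := varpi_ge; lra.
(* The slack is chosen so that [varpi] plus slack equals [varpi] times exp(e), which becomes an
   additive [e] under the logarithm. *)
have [||_ [M /= M0 <-]] := @inf_adherent R [set (\prod_(1 <= i < M.+1)
              Num.max (2 * (gcdn i M)%:R / (sigma (gcdn i M))%:R) 1)
             `^ (M%:R^-1) | M in [set M : nat | (0 < M)%N]] (varpi R * (expR e - 1)).
- by rewrite mulr_gt0// subr_gt0 expR_gt1.
- split; first by eexists; exists 1%N => //; reflexivity.
  by exists 0 => _ [N /= N0 <-]; exact: powR_ge0.
rewrite -/(varpi R) mulrBr mulr1 addrC subrK varpi_termE//.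
rewrite -[X in X * expR e]lnK ?posrE// -expRD ltr_expR ltr_pdivrMr ?ltr0n// mulrC => /ltW.
by exists M.
Qed.

End Defect.

(** * Bounds of Mertens type for sums over primes *)

Section PrimeSums.
Set Implicit Arguments.
Unset Strict Implicit.
Variable R : realType.

Definition primes_in (a b : nat) : seq nat :=
  [seq p <- index_iota a.+1 b.+1 | prime p].

Lemma mem_primes_in a b p : (p \in primes_in a b) = prime p && (a < p <= b)%N.
Proof. by rewrite mem_filter mem_index_iota. Qed.

Lemma primes_in_uniq a b : uniq (primes_in a b).
Proof. by rewrite filter_uniq// iota_uniq. Qed.

Lemma primes_in_all a b : all prime (primes_in a b).
Proof. by apply/allP => p; rewrite mem_primes_in => /andP[]. Qed.

(** Bounding ln at 1/(1 + t) by its tangent gives ln(1 + t) >= t/(1 + t), which exceeds t - t^2 by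
    t^3/(1 + t). *)
Lemma ln1D_ge (t : R) : 0 <= t -> t - t ^+ 2 <= ln (1 + t).
Proof.
move=> t0; have t1 : 0 < 1 + t by lra.
have : ln (1 + (- (t / (1 + t)))) <= - (t / (1 + t)).
  by apply: le_ln1Dx; rewrite ltrN2 ltr_pdivrMr// mul1r; lra.
have -> : 1 + (- (t / (1 + t))) = (1 + t)^-1 by field; rewrite gt_eqF.
rewrite lnV ?posrE// lerN2; apply: le_trans.
rewrite -subr_ge0 (_ : _ - _ = t ^+ 3 / (1 + t)); last by field; rewrite gt_eqF.
by rewrite divr_ge0// ?exprn_ge0// ltW.
Qed.

Lemma ln_succ_le n : (0 < n)%N -> ln (n.+1%:R) - ln n%:R <= (n%:R)^-1 :> R.
Proof.
move=> n0; have n0' : 0 < n%:R :> R by rewrite ltr0n.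
rewrite -ln_div ?posrE ?ltr0n//.
have -> : n.+1%:R / n%:R = 1 + n%:R^-1 :> R.
  by rewrite -natr1; field; rewrite gt_eqF.
by apply: le_ln1Dx; apply: (@lt_le_trans _ _ 0) => //; rewrite invr_ge0 ltW.
Qed.

Lemma ln_succ_ge n : (0 < n)%N -> (n.+1%:R)^-1 <= ln (n.+1%:R) - ln n%:R :> R.
Proof.
move=> n0; have n0' : 0 < n%:R :> R by rewrite ltr0n.
rewrite -lerN2 opprB -ln_div ?posrE ?ltr0n//.
have -> : n%:R / n.+1%:R = 1 + - (n.+1%:R)^-1 :> R.
  by rewrite -natr1; field; rewrite gt_eqF// ltr_wpDl.
apply: le_ln1Dx; rewrite ltrN2 invf_lt1 ?ltr0n// ltr1n ltnS//.
Qed.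

Lemma sum_inv_sqr_primes_le z :
  \sum_(p <- primes_in 0 z) (p%:R ^+ 2)^-1 <= 7 / 4 :> R.
Proof.
apply: le_trans (sum_inv_sqr_le R z); apply: ler_sum_subset.
- by move=> i; rewrite invr_ge0 exprn_ge0.
- exact: primes_in_uniq.
- by move=> p; rewrite mem_primes_in mem_index_iota ltnS => /andP[].
Qed.

(* Multiplying by [1 + f p] a sum over the [n <= N] coprime to [p] and to the
   primes in [s] gives part of the sum over the [n <= p * N] coprime to the
   primes in [s]; this induction replaces unique factorization. *)
Lemma prod_1D_le (f : nat -> R) (Z : R) (s : seq nat) :
  (forall n, 0 <= f n) -> f 1%N = 1 ->
  (forall m n, (0 < m)%N -> (0 < n)%N -> f (m * n)%N = f m * f n) ->
  (forall N, \sum_(1 <= n < N.+1) f n <= Z) ->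
  all prime s -> uniq s -> \prod_(p <- s) (1 + f p) <= Z.
Proof.
move=> f0 f1 fM fZ.
pose u (s : seq nat) N := [seq n <- index_iota 1 N.+1 | all (fun p => ~~ (p %| n)%N) s].
have uP s' N n : (n \in u s' N) = all (fun p => ~~ (p %| n)%N) s' && (0 < n <= N)%N.
  by rewrite mem_filter mem_index_iota.
have uU s' N : uniq (u s' N) by rewrite filter_uniq// iota_uniq.
have step p s' N : prime p -> all prime s' -> p \notin s' ->
    (1 + f p) * \sum_(n <- u (p :: s') N) f n <= \sum_(n <- u s' (p * N)%N) f n.
  move=> pp /allP ps' pns; have p0 := prime_gt0 pp.
  rewrite mulrDl mul1r mulr_sumr.
  have -> : \sum_(n <- u (p :: s') N) f p * f n =
      \sum_(n <- [seq p * n | n <- u (p :: s') N]%N) f n.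
    rewrite big_map big_seq [RHS]big_seq; apply: eq_bigr => n.
    by rewrite uP => /and3P[_ n0 _]; rewrite fM.
  rewrite -big_cat; apply: ler_sum_subset => //.
    rewrite cat_uniq uU map_inj_uniq ?uU ?andbT/=; last first.
      by move=> a b /eqP; rewrite eqn_pmul2l// => /eqP.
    apply/hasPn => d /mapP[e _ ->]; rewrite /= uP /=.
    by rewrite dvdn_mulr.
  move=> d; rewrite mem_cat => /orP[|/mapP[n + ->]]; rewrite !uP /=.
    move=> /and3P[/andP[_ ->] -> /= dN].
    by rewrite (leq_trans dN)// leq_pmull.
  move=> /and3P[/andP[_ /allP ns] n0 nN].
  rewrite muln_gt0 p0 n0 leq_pmul2l// nN !andbT/=.
  apply/allP => q qs; rewrite Euclid_dvdM ?ps'// negb_or ns// andbT.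
  by apply: contra pns; rewrite (dvdn_prime2 (ps' _ qs) pp) => /eqP <-.
have main s' N : all prime s' -> uniq s' ->
    \prod_(p <- s') (1 + f p) * \sum_(n <- u s' N) f n <= Z.
  elim: s' N => [|p s' IH] N /=.
    by move=> _ _; rewrite big_nil mul1r big_filter; apply: fZ.
  move=> /andP[pp ps'] /andP[pns us']; rewrite big_cons mulrAC mulrC.
  apply: le_trans (IH (p * N)%N ps' us'); apply: ler_wpM2l; last exact: step.
  by apply: prodr_ge0 => q _; rewrite addr_ge0.
move=> ps us; have := main s 1%N ps us; apply: le_trans.
rewrite /u /index_iota /= ifT ?big_seq1 ?f1 ?mulr1//.
by apply/allP => p /(allP ps) pp; rewrite dvdn1 gtn_eqF ?prime_gt1.
Qed.

(** Sieving by one prime at a time: the multiples of [p] among the remaining integers are [p] times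
    remaining integers, so the sums x before and y after removing them satisfy x <= y + x/p, that
    is, x <= (1 + 1/(p - 1)) y. *)
Lemma harmonic_le_prod N :
  \sum_(1 <= n < N.+1) n%:R^-1 <= \prod_(p <- primes_in 0 N) (1 + p.-1%:R^-1) :> R.
Proof.
pose u (s : seq nat) := [seq n <- index_iota 1 N.+1 | all (fun p => ~~ (p %| n)%N) s].
have uP s' n : (n \in u s') = all (fun p => ~~ (p %| n)%N) s' && (0 < n <= N)%N.
  by rewrite mem_filter mem_index_iota.
have uU s' : uniq (u s') by rewrite filter_uniq// iota_uniq.
have step p s' : prime p ->
    \sum_(n <- u s') n%:R^-1 <= (1 + p.-1%:R^-1) * \sum_(n <- u (p :: s')) n%:R^-1 :> R.
  move=> pp; have p0 := prime_gt0 pp.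
  have p1 : 0 < p.-1%:R :> R by rewrite ltr0n; have := prime_gt1 pp; lia.
  have pE : p%:R = p.-1%:R + 1 :> R by rewrite natr1 prednK.
  have : \sum_(n <- u s') n%:R^-1 <= \sum_(n <- u (p :: s')) n%:R^-1
      + p%:R^-1 * \sum_(n <- u s') n%:R^-1 :> R.
    have -> : p%:R^-1 * \sum_(n <- u s') n%:R^-1 =
        \sum_(n <- [seq p * n | n <- u s']%N) n%:R^-1 :> R.
      by rewrite big_map mulr_sumr; apply: eq_bigr => n _; rewrite natrM invfM.
    rewrite -big_cat; apply: ler_sum_subset => // d; rewrite mem_cat !uP /=.
    have [/dvdnP[n ->]|_ -> //] := boolP (p %| d)%N.
    move=> /and3P[/allP ns]; rewrite muln_gt0 p0 andbT => n0 nN.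
    rewrite mulnC map_f// uP n0 (leq_trans _ nN) ?leq_pmulr// !andbT.
    by apply/allP => q /ns; apply: contra => /dvdn_trans; apply; rewrite dvdn_mulr.
  rewrite pE; move: (\sum_(n <- u s') _) (\sum_(n <- u (p :: s')) _) => x y.
  move: p.-1%:R p1 => q q0 H; have q1 : 0 < q + 1 by lra.
  have -> : 1 + q^-1 = (q + 1) / q by field; rewrite gt_eqF.
  rewrite mulrAC ler_pdivlMr//.
  have -> : x * q = (x - (q + 1)^-1 * x) * (q + 1) by field; rewrite gt_eqF.
  by rewrite [leRHS]mulrC ler_pM2r// lerBlDr.
have main s' : all prime s' ->
    \sum_(1 <= n < N.+1) n%:R^-1 <=
    \prod_(p <- s') (1 + p.-1%:R^-1) * \sum_(n <- u s') n%:R^-1 :> R.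
  elim: s' => [|p s' IH] /=; first by move=> _; rewrite big_nil mul1r big_filter.
  move=> /andP[pp /IH /le_trans]; apply; rewrite big_cons mulrAC mulrC.
  by apply: ler_wpM2r; [apply: prodr_ge0 => q _; rewrite addr_ge0|rewrite step].
apply: (le_trans (main _ (primes_in_all 0 N))).
rewrite ler_piMr//; first by apply: prodr_ge0 => q _; rewrite addr_ge0.
(* Only n = 1 survives the sieve, since the least prime factor of any other n is at most [N]. *)
apply: (@le_trans _ _ (\sum_(n <- [:: 1%N]) n%:R^-1)); last by rewrite big_seq1 invr1.
apply: ler_sum_subset => // n; rewrite uP => /and3P[/allP ns n0 nN].
rewrite mem_seq1; apply: contraT => n1.
have pp : prime (pdiv n) by apply: pdiv_prime; lia.
have : pdiv n \in primes_in 0 N.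
  by rewrite mem_primes_in pp pdiv_gt0 (leq_trans _ nN)// dvdn_leq// pdiv_dvd.
by move/ns; rewrite pdiv_dvd.
Qed.

Lemma ln_le_harmonic N : ln N.+1%:R <= \sum_(1 <= n < N.+1) n%:R^-1 :> R.
Proof.
elim: N => [|N IH]; first by rewrite ln1 big_geq.
rewrite big_nat_recr//=; apply: le_trans (lerD IH (ln_succ_le (ltn0Sn N))).
by rewrite addrC subrK.
Qed.

Lemma ln_nat_gt0 n : (1 < n)%N -> 0 < ln n%:R :> R.
Proof. by move=> n1; rewrite ln_gt0// ltr1n. Qed.

Lemma ln2_ge : 1 / 2 <= ln 2 :> R.
Proof. by have := ln_succ_ge (ltn0Sn 0); rewrite ln1; lra. Qed.

Lemma sum_ln1D_primes_ge z : (1 < z)%N ->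
  ln (ln z%:R) - 4 <= \sum_(p <- primes_in 0 z) ln (1 + p%:R^-1) :> R.
Proof.
move=> z1.
have lz : 0 < ln z%:R :> R by rewrite ln_nat_gt0.
have Hp p : p \in primes_in 0 z -> exists2 q : R, q >= 1 & p.-1%:R = q /\ p%:R = q + 1.
  rewrite mem_primes_in => /andP[/prime_gt1 p1 _]; exists p.-1%:R.
    by rewrite ler1n; lia.
  by rewrite natr1 prednK// ltnW.
(* Passing to p - 1 brings in the factors that bound the harmonic sum; the squares cost at most 2
   times 7/4, which 4 covers. *)
apply: (@le_trans _ _ (\sum_(p <- primes_in 0 z) (p.-1%:R^-1 - 2 * (p.-1%:R ^+ 2)^-1))); last first.
  rewrite big_seq [leRHS]big_seq; apply: ler_sum => p /Hp[q q1 [-> ->]].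
  have q0 : 0 < q by lra.
  apply: le_trans (ln1D_ge _); last by rewrite invr_ge0; lra.
  rewrite -subr_ge0.
  have -> : (q + 1)^-1 - (q + 1)^-1 ^+ 2 - (q^-1 - 2 * (q ^+ 2)^-1) =
      (3 * q + 2) / (q ^+ 2 * (q + 1) ^+ 2).
    by field; rewrite !gt_eqF//; lra.
  by rewrite divr_ge0// ?mulr_ge0// ?exprn_ge0//; lra.
rewrite sumrB -mulr_sumr; apply: lerB.
  apply: (@le_trans _ _ (ln (\prod_(p <- primes_in 0 z) (1 + p.-1%:R^-1)))).
    have H : ln z%:R <= \prod_(p <- primes_in 0 z) (1 + p.-1%:R^-1) :> R.
      apply: le_trans (harmonic_le_prod z); apply: le_trans (ln_le_harmonic z).
      by rewrite ler_ln ?posrE ?ltr0n ?ler_nat//; lia.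
    by rewrite ler_ln ?posrE//; apply: lt_le_trans H.
  have P0 (s : seq nat) : 0 < \prod_(p <- s) (1 + p.-1%:R^-1) :> R.
    by apply: prodr_gt0 => p _; rewrite ltr_pwDl// invr_ge0.
  elim: (primes_in 0 z) => [|p s IH]; first by rewrite !big_nil ln1.
  have p0 : 0 <= p.-1%:R^-1 :> R by rewrite invr_ge0.
  rewrite !big_cons lnM ?posrE// ?ltr_pwDl//.
  by apply: lerD => //; apply: le_ln1Dx; lra.
suff : \sum_(p <- primes_in 0 z) (p.-1%:R ^+ 2)^-1 <= 7 / 4 :> R by lra.
apply: le_trans (sum_inv_sqr_le R z).
have -> : \sum_(p <- primes_in 0 z) (p.-1%:R ^+ 2)^-1 =
    \sum_(n <- [seq p.-1 | p <- primes_in 0 z]) (n%:R ^+ 2)^-1 :> R.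
  by rewrite big_map.
apply: ler_sum_subset.
- by move=> i; rewrite invr_ge0 exprn_ge0.
- rewrite map_inj_in_uniq ?primes_in_uniq// => a b; rewrite !mem_primes_in.
  by move=> /and3P[/prime_gt1 a1 _ _] /and3P[/prime_gt1 b1 _ _]; lia.
- move=> n /mapP[p]; rewrite mem_primes_in mem_index_iota => /and3P[/prime_gt1 p1 _ pz] ->.
  by lia.
Qed.

(** The terms n^(-1-d) telescope against n^(-d) / d, a discrete integral test for zeta(1 + d). *)
Lemma zeta_le (d : R) N : 0 < d ->
  \sum_(1 <= n < N.+1) n%:R^-1 * expR (- d * ln n%:R) <= 1 + d^-1.
Proof.
move=> d0.
have H n : \sum_(1 <= n < n.+2) n%:R^-1 * expR (- d * ln n%:R) <=
    1 + d^-1 * (1 - expR (- d * ln n.+1%:R)).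
  elim: n => [|n IH]; first by rewrite big_nat1 ln1 mulr0 expR0 invr1; lra.
  rewrite big_nat_recr//=; apply: (le_trans (lerD IH (lexx _))).
  suff : n.+2%:R^-1 * expR (- d * ln n.+2%:R) <=
      d^-1 * (expR (- d * ln n.+1%:R) - expR (- d * ln n.+2%:R)).
    move: (d^-1) (n.+2%:R^-1) (expR (- d * ln n.+1%:R)) (expR (- d * ln n.+2%:R)).
    by move=> x c u v; rewrite !mulrBr; lra.
  pose t : R := ln n.+2%:R - ln n.+1%:R.
  have -> : - d * ln n.+1%:R = d * t + - d * ln n.+2%:R by rewrite /t; ring.
  rewrite expRD -[X in _ * (_ - X)]mul1r -mulrBl mulrA ler_pM2r ?expR_gt0// mulrC ler_pdivlMr//.
  apply: (@le_trans _ _ (d * t)); last by have := expR_ge1Dx (d * t); lra.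
  by rewrite mulrC ler_pM2l// /t ln_succ_ge.
have id0 : 0 < d^-1 by rewrite invr_gt0.
case: N => [|N]; first by rewrite big_geq//; lra.
apply: (le_trans (H N)); rewrite lerD2l ler_piMr ?ltW//.
by have := expR_gt0 (- d * ln N.+1%:R); lra.
Qed.

(** Rankin's trick: with d of order 1 / ln z, the weight p^(-d) costs a factor at most 1 + e for p
    <= z, while the product of the 1 + p^(-1-d) is at most 1 + 1/d, of order ln z. *)
Lemma sum_inv_primes_le (e : R) : 0 < e -> exists C : R, forall z, (1 < z)%N ->
  \sum_(p <- primes_in 0 z) p%:R^-1 <= (1 + e) * ln (ln z%:R) + C.
Proof.
move=> e0; have l0 : 0 < ln (1 + e) by rewrite ln_gt0//; lra.
exists ((1 + e) * (ln (2 + (ln (1 + e))^-1) + 7 / 4)) => z z1.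
have lz : 0 < ln z%:R :> R by rewrite ln_nat_gt0.
have lz2 : 1 / 2 <= ln z%:R :> R.
  by apply: (le_trans ln2_ge); rewrite ler_ln ?posrE ?ltr0n ?ler_nat//; lia.
(* This choice of [d] gives [p `^ (- d) >= (1 + e)^-1] for every [p <= z]. *)
pose d := ln (1 + e) / ln z%:R; have d0 : 0 < d by rewrite divr_gt0.
pose f n : R := n%:R^-1 * expR (- d * ln n%:R).
have f0 n : 0 <= f n by rewrite mulr_ge0 ?invr_ge0 ?expR_ge0.
rewrite -mulrDr mulrC -ler_pdivrMr; last by lra.
rewrite mulr_suml.
apply: (@le_trans _ _ (\sum_(p <- primes_in 0 z) (ln (1 + f p) + (p%:R ^+ 2)^-1))).
  rewrite big_seq [leRHS]big_seq; apply: ler_sum => p.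
  rewrite mem_primes_in => /and3P[_ p0 pz].
  have p0' : 0 < p%:R :> R by rewrite ltr0n.
  have dlp : d * ln p%:R <= ln (1 + e).
    rewrite /d mulrAC ler_pdivrMr// ler_pM2l// ler_ln ?posrE ?ltr0n ?ler_nat//.
    by lia.
  apply: (@le_trans _ _ (f p)).
    rewrite /f ler_pM2l ?invr_gt0//.
    rewrite -[X in X^-1]lnK ?posrE; last by lra.
    by rewrite -expRN ler_expR mulNr lerN2.
  have fp : f p <= p%:R^-1.
    rewrite /f ler_piMr ?invr_ge0// expR_le1 mulNr oppr_le0 mulr_ge0 ?(ltW d0)//.
    by rewrite ln_ge0// ler1n.
  have fp2 : f p ^+ 2 <= (p%:R ^+ 2)^-1.
    by rewrite -exprVn ler_pXn2r// nnegrE ?invr_ge0.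
  have := ln1D_ge (f0 p); lra.
rewrite big_split/= addrA; apply: lerD; last exact: sum_inv_sqr_primes_le.
have -> : \sum_(p <- primes_in 0 z) ln (1 + f p) = ln (\prod_(p <- primes_in 0 z) (1 + f p)).
  have P0 (s : seq nat) : 0 < \prod_(p <- s) (1 + f p).
    by apply: prodr_gt0 => p _; rewrite ltr_pwDl.
  elim: (primes_in 0 z) => [|p s IH]; first by rewrite !big_nil ln1.
  by rewrite !big_cons lnM ?posrE ?ltr_pwDl// IH.
have c0 : 0 < 2 + (ln (1 + e))^-1 by rewrite ltr_pwDl// invr_ge0 ltW.
rewrite -lnM ?posrE// ler_ln ?posrE ?mulr_gt0//; last first.
  by apply: prodr_gt0 => p _; rewrite ltr_pwDl.
(* Here 1/d = ln z / ln(1 + e), and the summand 1 is absorbed by 2 ln z because ln z >= 1/2. *)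
apply: (@le_trans _ _ (1 + d^-1)).
  apply: prod_1D_le => //.
  - by rewrite /f ln1 mulr0 expR0 invr1 mulr1.
  - move=> m n m0 n0; rewrite /f natrM invfM lnM ?posrE ?ltr0n// mulrDr expRD.
    by rewrite mulrACA.
  - by move=> N; exact: zeta_le.
  - exact: primes_in_all.
  - exact: primes_in_uniq.
by rewrite /d invf_div mulrDr; lra.
Qed.

End PrimeSums.

(** * Upper bound for the length of a run of abundant numbers *)

Section Upper.
Set Implicit Arguments.
Unset Strict Implicit.
Variable R : realType.
Local Notation L := (ln (varpi R)).

Lemma count_dvd_le d m k : (0 < m)%N ->
  (\sum_(m <= i < m + k) (d %| i) <= k %/ d + 1)%N.
Proof.
case: m => // m _.
have := divn_count_dvd d (m + k); rewrite -addSn (@big_cat_nat _ _ _ m.+1)//= ?leq_addr//.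
rewrite -divn_count_dvd; have [->|d0] := posnP d.
  by rewrite !divn0; lia.
by rewrite divnD//; case: leq; lia.
Qed.

Lemma size_primes_le n : (0 < n)%N -> (2 ^ size (primes n) <= n)%N.
Proof.
move=> n0; rewrite [leqRHS](prod_prime_decomp n0) /primes /unzip1 size_map.
have : all (fun f => 2 <= f.1 ^ f.2)%N (prime_decomp n).
  apply/allP => -[p e] /mem_prime_decomp[pp e0 _] /=.
  by rewrite (leq_trans (prime_gt1 pp))// -{1}(expn1 p) leq_exp2l// prime_gt1.
elim: (prime_decomp n) => [|f s IH] /=; first by rewrite big_nil.
by move=> /andP[f2 /IH ps]; rewrite big_cons expnS leq_mul.
Qed.

(** The integers up to [y] contribute 1/y in total, and those beyond telescope to at most 1/y. *)
Lemma sum_primes_tail_le (y W : nat) : (0 < y)%N ->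
  \sum_(p <- primes W) (if (p <= y)%N then (y%:R ^+ 2)^-1 else p.-1%:R^-1 - p%:R^-1) <=
  2 / y%:R :> R.
Proof.
move=> y0; pose g n : R := if (n <= y)%N then (y%:R ^+ 2)^-1 else n.-1%:R^-1 - n%:R^-1.
have y0' : 0 < y%:R :> R by rewrite ltr0n.
have g0 n : 0 <= g n.
  rewrite /g; case: leqP => [_|yn]; first by rewrite invr_ge0 exprn_ge0.
  have n1 : (0 < n.-1)%N by lia.
  by rewrite subr_ge0 lef_pV2 ?posrE ?ltr0n ?ler_nat//; lia.
have gB B : \sum_(1 <= n < (y + B).+1) g n <= 2 / y%:R - (y + B)%:R^-1.
  elim: B => [|B IH].
    rewrite addn0; under eq_big_nat => n /andP[_ ny] do rewrite /g -ltnS ny.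
    rewrite sumr_const_nat subn1 /= -(mulr_natl (_^-1)).
    by rewrite le_eqVlt; apply/orP; left; apply/eqP; field; rewrite gt_eqF.
  rewrite addnS big_nat_recr//=; apply: (le_trans (lerD IH (lexx _))).
  by rewrite /g leqNgt ltnS leq_addr /= addrA subrK.
apply: (@le_trans _ _ (\sum_(1 <= n < (y + W).+1) g n)); last first.
  by apply: (le_trans (gB W)); rewrite lerBlDr lerDl invr_ge0.
apply: (@ler_sum_subset _ _ _ g) => //; first exact: primes_uniq.
move=> p; rewrite mem_primes mem_index_iota => /and3P[pp W0 pW].
by rewrite prime_gt0//= ltnS (leq_trans (dvdn_leq W0 pW))// leq_addl.
Qed.

(** As [W] has at most [z] prime factors, those above [z] add at most 1 to the sum of 1/p; replacing
    1/(p - 1) by 1/p costs the other 2. *)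
Lemma sum_prime_divisors_le W z : (0 < z)%N -> (0 < W)%N -> (W <= 2 ^ z)%N ->
  \sum_(p <- primes W) p.-1%:R^-1 <= \sum_(p <- primes_in 0 z) p%:R^-1 + 3 :> R.
Proof.
move=> z0 W0 Wz; have z0' : 0 < z%:R :> R by rewrite ltr0n.
(* Taking y = 1 leaves only the telescoping differences, no prime being at most 1. *)
have T := sum_primes_tail_le W (ltn0Sn 0).
apply: (@le_trans _ _ (\sum_(p <- primes W) (p%:R^-1 +
  (if (p <= 1)%N then (1%:R ^+ 2)^-1 else p.-1%:R^-1 - p%:R^-1)))).
  rewrite big_seq [leRHS]big_seq; apply: ler_sum => p; rewrite mem_primes.
  by move=> /and3P[/prime_gt1 p1 _ _]; rewrite leqNgt p1/=; lra.
rewrite big_split/=; suff : \sum_(p <- primes W) p%:R^-1 <=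
  \sum_(p <- primes_in 0 z) p%:R^-1 + 1 :> R by move: T; lra.
apply: (@le_trans _ _ (\sum_(p <- primes W) ((if (p <= z)%N then p%:R^-1 else 0) + z%:R^-1))).
  apply: ler_sum => p _; case: leqP => pz; first by rewrite lerDl invr_ge0.
  by rewrite add0r lef_pV2 ?posrE ?ltr0n ?ler_nat//; lia.
rewrite big_split/=; apply: lerD.
  rewrite -big_mkcond -big_filter; apply: ler_sum_subset => //.
    by rewrite filter_uniq// primes_uniq.
  move=> p; rewrite mem_filter mem_primes mem_primes_in => /andP[-> /and3P[pp _ _]].
  by rewrite pp prime_gt0.
rewrite big_const_seq count_predT iter_addr_0 -(mulr_natl (_^-1)) ler_pdivrMr// mul1r.
rewrite ler_nat -(@leq_exp2l 2)//; apply: leq_trans Wz; exact: size_primes_le.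
Qed.

Lemma abundant_run_upper (e : R) : 0 < e -> exists C : R, forall m k z,
  (0 < m)%N -> (1 < z)%N -> (forall j, (j < k)%N -> abundant (m + j)) ->
  (\prod_(m <= i < m + k) i <= 2 ^ z)%N ->
  k%:R * (L - e) <= (1 + e) * ln (ln z%:R) + C.
Proof.
move=> e0; have [C0 HC0] := sum_inv_primes_le e0.
pose y := (Num.truncn (2 / e)).+1; have y0 : (0 < y)%N by [].
have ye : 2 / y%:R <= e.
  rewrite ler_pdivrMr ?ltr0n// mulrC -ler_pdivrMr//.
  by apply: ltW; rewrite /y truncnS_gt.
pose M := ((y ^ 2)`!)%N; have M0 : (0 < M)%N by exact: fact_gt0.
(* [q p] is the least power of [p] that does not divide [M]. *)
pose q p := (p ^ (logn p M).+1)%N.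
(* Every positive integer up to y^2 divides [M], whereas [q p] does not. *)
have qy p : prime p -> (y ^ 2 < q p)%N.
  move=> pp; rewrite ltnNge; apply/negP => qle.
  have : (q p %| M)%N by rewrite dvdn_fact// qle expn_gt0 prime_gt0.
  by rewrite /q pfactor_dvdn// ltnn.
have qp p : prime p -> (p <= q p)%N.
  by move=> pp; rewrite -{1}(expn1 p) leq_exp2l ?prime_gt1.
(* [C0] comes from the Mertens bound, 3 from passing to the primes up to [z], and the last term from
   an incomplete period. *)
exists (C0 + 3 + M%:R * L) => m k z m0 z1 run Wz.
set W := (\prod_(m <= i < m + k) i)%N in Wz.
have W0 : (0 < W)%N.
  rewrite /W big_seq; apply: prodn_cond_gt0 => i; rewrite mem_index_iota.
  by case/andP => /(leq_trans m0).
have low := sum_defect_ge m k M0 (ltW (ln_varpi_gt0 R)) (total_defect_ge_ln_varpi R M0).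
suff up : \sum_(m <= i < m + k) defect R M i <= k%:R * e + \sum_(p <- primes W) p.-1%:R^-1.
  have := sum_prime_divisors_le (ltnW z1) W0 Wz; have := HC0 z z1.
  move: low up; lra.
(* A prime factor of i / (i, M) divides i to a higher power than it divides [M], so [q p] divides
   i. *)
apply: (@le_trans _ _ (\sum_(m <= i < m + k) \sum_(p <- primes W) (q p %| i)%:R * p.-1%:R^-1)).
  rewrite big_seq [leRHS]big_seq; apply: ler_sum => i; rewrite mem_index_iota => /andP[mi ik].
  have i0 : (0 < i)%N by exact: leq_trans mi.
  have ai : abundant i by rewrite -(subnKC mi); apply: run; lia.
  have g0 : (0 < gcdn i M)%N by rewrite gcdn_gt0 M0 orbT.
  have ig0 : (0 < i %/ gcdn i M)%N by rewrite divn_gt0// dvdn_leq// dvdn_gcdl.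
  apply: (le_trans (abundant_defect R M0 ai)); apply: (le_trans (ln_abundancy_le R ig0)).
  have -> : \sum_(p <- primes W) (q p %| i)%:R * p.-1%:R^-1 =
      \sum_(p <- [seq p <- primes W | (q p %| i)%N]) p.-1%:R^-1 :> R.
    rewrite big_filter [RHS]big_mkcond; apply: eq_bigr => p _.
    by case: ifP; rewrite ?mul1r ?mul0r.
  apply: ler_sum_subset; [by move=> p; rewrite invr_ge0|exact: primes_uniq|].
  move=> p; rewrite mem_primes => /and3P[pp _ pig].
  have pi : (p %| i)%N.
    by rewrite -(divnK (dvdn_gcdl i M)); apply: dvdn_trans pig _; rewrite dvdn_mulr.
  rewrite mem_filter mem_primes pp W0/=; apply/andP; split; last first.
    apply: dvdn_trans pi _; rewrite /W (big_rem i) ?dvdn_mulr//=.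
    by rewrite mem_index_iota mi.
  rewrite /q pfactor_dvdn// ltnNge; apply/negP => le_log.
  have : (0 < logn p (i %/ gcdn i M))%N by rewrite logn_gt0 mem_primes pp ig0.
  by rewrite logn_div ?dvdn_gcdl// logn_gcd// (minn_idPl le_log) subnn.
rewrite exchange_big/=.
(* At most k / q(p) + 1 members of the run are multiples of [q p]. For p <= y use q(p) > y^2; for p
   > y use q(p) >= p, which gives the telescoping 1/(p (p - 1)). *)
apply: (@le_trans _ _ (\sum_(p <- primes W) (k%:R *
  (if (p <= y)%N then (y%:R ^+ 2)^-1 else p.-1%:R^-1 - p%:R^-1) + p.-1%:R^-1))).
  rewrite big_seq [leRHS]big_seq; apply: ler_sum => p; rewrite mem_primes => /and3P[pp _ _].
  rewrite -mulr_suml -natr_sum.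
  have p1 := prime_gt1 pp; have p1' : 1 <= p.-1%:R :> R by rewrite ler1n; lia.
  have pE : p%:R = p.-1%:R + 1 :> R by rewrite natr1 prednK// ltnW.
  have q0' : (0 < q p)%N by rewrite expn_gt0 prime_gt0.
  have p0' : (0 < p.-1)%N by lia.
  have q0 : 0 < (q p)%:R :> R by rewrite ltr0n.
  have cnt : (\sum_(m <= i < m + k) (q p %| i))%N%:R <= k%:R / (q p)%:R + 1 :> R.
    apply: (@le_trans _ _ (k %/ q p + 1)%N%:R); first by rewrite ler_nat count_dvd_le.
    rewrite natrD lerD2r ler_pdivlMr// -natrM ler_nat; exact: leq_trunc_div.
  apply: (@le_trans _ _ ((k%:R / (q p)%:R + 1) * p.-1%:R^-1)).
    by apply: ler_wpM2r => //; rewrite invr_ge0.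
  rewrite mulrDl mul1r lerD2r -mulrA; apply: ler_wpM2l => //.
  rewrite -invfM; case: ifP => py.
    rewrite lef_pV2 ?posrE ?mulr_gt0 ?exprn_gt0 ?ltr0n//.
    apply: (@le_trans _ _ (q p)%:R); first by rewrite -natrX ler_nat ltnW// qy.
    by rewrite ler_peMr// ltW.
  have -> : p.-1%:R^-1 - p%:R^-1 = (p%:R * p.-1%:R)^-1 :> R.
    by rewrite pE; field; rewrite !gt_eqF//; lra.
  rewrite lef_pV2 ?posrE ?mulr_gt0 ?ltr0n ?(prime_gt0 pp)//.
  by apply: ler_wpM2r => //; rewrite ler_nat qp.
rewrite big_split/= lerD2r -mulr_sumr; apply: ler_wpM2l => //.
exact: le_trans (sum_primes_tail_le W y0) ye.
Qed.

End Upper.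

(** * Construction of long runs by the Chinese remainder theorem *)

Section Lower.
Set Implicit Arguments.
Unset Strict Implicit.
Variable R : realType.
Local Notation L := (ln (varpi R)).

Lemma chinese_shift P (Q : nat -> nat) k : (0 < P)%N ->
  (forall i, 0 < Q i)%N -> (forall i, coprime P (Q i)) ->
  (forall i j, (i < j)%N -> coprime (Q i) (Q j)) ->
  exists m, [/\ (m < P * \prod_(i < k) Q i)%N, (P %| m)%N &
    forall i, (i < k)%N -> (Q i %| m + i.+1)%N].
Proof.
move=> P0 Q0 PQ QQ; elim: k => [|k [m [mlt Pm Qm]]].
  by exists 0%N; split=> //; rewrite big_ord0 muln1.
set PP := (P * \prod_(i < k) Q i)%N in mlt.
have PP0 : (0 < PP)%N by rewrite muln_gt0 P0 prodn_gt0.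
have co : coprime PP (Q k).
  rewrite coprimeMl PQ/=; apply: (big_ind (fun x => coprime x (Q k))).
  - exact: coprime1n.
  - by move=> x y cx cy; rewrite coprimeMl cx.
  - by move=> i _; exact: QQ.
(* A nonnegative representative of -(k + 1) modulo [Q k]. *)
pose r := (Q k * k.+1 - k.+1)%N.
have rE : (r + k.+1 = Q k * k.+1)%N by rewrite subnK// leq_pmull.
pose x := (chinese PP (Q k) m r %% (PP * Q k))%N.
have xPP : x = m %[mod PP].
  by rewrite /x (modn_dvdm _ (dvdn_mulr _ (dvdnn PP))) (chinese_modl co).
have xQ : x = r %[mod Q k].
  by rewrite /x (modn_dvdm _ (dvdn_mull _ (dvdnn (Q k)))) (chinese_modr co).
have xlt : (x < PP * Q k)%N by rewrite ltn_mod muln_gt0 PP0 Q0.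
clearbody x; exists x; split.
- by rewrite big_ord_recr/= mulnA.
- have : (x %% PP %% P = m %% PP %% P)%N by rewrite xPP.
  by rewrite !modn_dvdm ?dvdn_mulr// /dvdn => ->.
- move=> i; rewrite ltnS leq_eqVlt => /predU1P[->|ik].
    by rewrite /dvdn -modnDml xQ modnDml rE modnMr.
  have QP : (Q i %| PP)%N.
    by rewrite dvdn_mull// (bigD1 (Ordinal ik))//= dvdn_mulr.
  have : (x %% PP %% Q i = m %% PP %% Q i)%N by rewrite xPP.
  rewrite !modn_dvdm// => E; have := Qm i ik.
  by rewrite /dvdn -modnDml -E modnDml.
Qed.

Definition euler_sum a b : R := \sum_(p <- primes_in a b) ln (1 + p%:R^-1).

Lemma euler_sum_cat b a c : (a <= b)%N -> (b <= c)%N ->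
  euler_sum a c = euler_sum a b + euler_sum b c.
Proof. by move=> ab bc; rewrite /euler_sum !big_filter -big_cat_nat. Qed.

Lemma euler_sum_recr a b : (a <= b)%N ->
  euler_sum a b <= euler_sum a b.+1 <= euler_sum a b + b.+1%:R^-1.
Proof.
move=> ab; rewrite (@euler_sum_cat b a b.+1)// lerDl lerD2l.
rewrite /euler_sum big_filter big_mkcond big_nat1.
have b0 : 0 <= b.+1%:R^-1 :> R by rewrite invr_ge0.
case: ifP => _; last by rewrite lexx b0.
move: (b.+1%:R^-1) b0 => u u0.
by rewrite ln_ge0 ?lerDl//=; apply: le_ln1Dx; lra.
Qed.

Lemma euler_sum_unbounded a (t : R) : exists2 b, (a < b)%N & t <= euler_sum a b.
Proof.
(* Chosen so that ln ln u exceeds by 4, the loss in the Mertens bound, the sum wanted plus the part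
   up to [a]. *)
pose u := expR (expR (t + euler_sum 0 a + 4)).
pose b := maxn a.+1 (Num.truncn u).+2.
have ab : (a < b)%N by rewrite leq_max leqnn.
have b1 : (1 < b)%N by rewrite leq_max !ltnS leq0n orbT.
exists b => //.
have ub : u <= b%:R.
  apply: (@le_trans _ _ (Num.truncn u).+1%:R); first by rewrite ltW// truncnS_gt.
  by rewrite ler_nat leq_max leqnSn orbT.
have := sum_ln1D_primes_ge R b1; rewrite -/(euler_sum 0 b) (@euler_sum_cat a)//; last exact: ltnW.
suff : t + euler_sum 0 a + 4 <= ln (ln b%:R) by lra.
have u0 : 0 < u by exact: expR_gt0.
have b0 : 0 < b%:R :> R by exact: lt_le_trans ub.
have lu : expR (t + euler_sum 0 a + 4) <= ln b%:R.
  by rewrite -ler_expR lnK.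
by rewrite -ler_expR lnK// posrE; apply: lt_le_trans lu; exact: expR_gt0.
Qed.

(** The least admissible [b] overshoots [t] by at most its own last term, hence by at most 1/b. *)
Lemma euler_sum_cut a (t : R) : 0 <= t -> exists b,
  [/\ (a < b)%N, t <= euler_sum a b & euler_sum a b <= t + b%:R^-1].
Proof.
move=> t0; have [b0 ab0 tb0] := euler_sum_unbounded a t.
have ex : exists b, (a < b)%N && (t <= euler_sum a b) by exists b0; rewrite ab0.
case: (ex_minnP ex) => -[//|b] /andP[ab tb] bmin; exists b.+1; split => //.
have /andP[_ ] := @euler_sum_recr a b ab; move=> /le_trans; apply; rewrite lerD2r.
move: ab; rewrite ltnS leq_eqVlt => /predU1P[->|ab].
  by rewrite /euler_sum big_filter big_geq.
rewrite leNgt; apply/negP => tlt.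
by have := bmin b; rewrite ab (ltW tlt) ltnn => /(_ isT).
Qed.

Lemma euler_sum_cuts y (t : nat -> R) : (0 < y)%N -> (forall i, 0 <= t i) ->
  exists z : nat -> nat, z 0%N = y /\ forall i, [/\ (z i < z i.+1)%N,
    t i <= euler_sum (z i) (z i.+1) & euler_sum (z i) (z i.+1) <= t i + y%:R^-1].
Proof.
move=> y0 t0; have [f fP] := choice (fun ai : nat * nat => euler_sum_cut ai.1 (t0 ai.2)).
(* The block index is passed to the choice function because the target [t i] varies with it. *)
pose z := nat_rect (fun=> nat) y (fun i a => f (a, i)).
have zS i : z i.+1 = f (z i, i) by [].
have zy i : (y <= z i)%N.
  elim: i => [//|i IH]; have [+ _ _] := fP (z i, i); rewrite -zS /=; lia.
exists z; split=> // i; have [/= lt1 lt2 lt3] := fP (z i, i); split=> //.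
apply: le_trans lt3 _; rewrite lerD2l lef_pV2 ?posrE ?ltr0n ?ler_nat//.
  by rewrite -zS zy.
by rewrite -zS (leq_trans y0).
Qed.

Lemma prod_primes_in_le a b : (0 < b)%N ->
  (\prod_(p <- primes_in a b) p <= b ^ (b - a))%N.
Proof.
move=> b0; apply: (@leq_trans (b ^ size (primes_in a b))).
  have : all (fun p => p <= b)%N (primes_in a b).
    by apply/allP => p; rewrite mem_primes_in => /and3P[].
  elim: (primes_in a b) => [|p s IH] /=; first by rewrite big_nil.
  by move=> /andP[pb /IH sb]; rewrite big_cons expnS leq_mul.
by rewrite leq_pexp2l// size_filter (leq_trans (count_size _ _))// size_iota subSS.
Qed.

Lemma abundant_run_lower (e : R) : 0 < e -> exists C : R, forall k,
  exists m z, [/\ (0 < m)%N, (1 < z)%N, forall j, (j < k)%N -> abundant (m + j),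
    (m + k <= z ^ (z + 2))%N & ln (ln z%:R) <= k%:R * (L + e) + C].
Proof.
(* One half of [e] pays for the choice of [M], the other for the overshoot of each block. *)
move=> e0; have e20 : 0 < e / 2 by rewrite divr_gt0.
have L0 := ln_varpi_gt0 R.
have [M M0 ML] := total_defect_near_ln_varpi e20.
(* Primes above [y] cannot divide [M], and overshoots are at most 1/y <= e/2. *)
pose y := maxn M (Num.truncn (2 / e)).+2.
have yM : (M <= y)%N by exact: leq_maxl.
have y1 : (1 < y)%N by rewrite leq_max !ltnS leq0n orbT.
have y0 : (0 < y)%N by exact: ltnW.
have ye : y%:R^-1 <= e / 2.
  rewrite -[e / 2]invf_div lef_pV2 ?posrE ?ltr0n ?divr_gt0//.
  apply: (@le_trans _ _ (Num.truncn (2 / e)).+1%:R); first by rewrite ltW// truncnS_gt.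
  by rewrite ler_nat leq_max leqnSn orbT.
have [z [z0 zP]] := @euler_sum_cuts y (fun i => defect R M i.+1) y0 (fun i => defect_ge0 R M i.+1).
have zlt i : (z i < z i.+1)%N by case: (zP i).
have zle i j : (i <= j)%N -> (z i <= z j)%N.
  by apply: (@homo_leq _ z leq) => // [a b c|a]; [exact: leq_trans|exact: ltnW].
have zy i : (y <= z i)%N by rewrite -z0 zle.
exists (4 + euler_sum 0 y + M%:R * (L + e / 2)) => k.
pose Q i := (\prod_(p <- primes_in (z i) (z i.+1)) p)%N.
have coQ a i : (forall p, p \in primes_in (z i) (z i.+1) -> coprime a p) -> coprime a (Q i).
  rewrite /Q big_seq => H; apply: (big_ind (fun x => coprime a x)) => //.
  - exact: coprimen1.
  - by move=> u v cu cv; rewrite coprimeMr cu.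
have Q0 i : (0 < Q i)%N.
  rewrite /Q big_seq; apply: prodn_cond_gt0 => p.
  by rewrite mem_primes_in => /andP[/prime_gt0].
have PQ i : coprime M (Q i).
  apply: coQ => p; rewrite mem_primes_in => /and3P[pp zp _].
  rewrite coprime_sym prime_coprime//; apply/negP => /(dvdn_leq M0) pM.
  by have := zy i; lia.
have QQ i j : (i < j)%N -> coprime (Q i) (Q j).
  move=> ij; apply: coQ => p; rewrite mem_primes_in => /and3P[pp zp _].
  rewrite coprime_sym /Q big_seq; apply: (big_ind (fun x => coprime p x)) => //.
  - exact: coprimen1.
  - by move=> u v cu cv; rewrite coprimeMr cu.
  - move=> q; rewrite mem_primes_in => /and3P[qp _ zq].
    rewrite prime_coprime// dvdn_prime2//; apply/eqP => pq.
    by have := zle _ _ ij; lia.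
have [m [mlt Mm Qm]] := chinese_shift k M0 Q0 PQ QQ.
have zk : (y + k <= z k)%N.
  by elim: {mlt Qm} k => [|k IH]; [rewrite addn0 z0|have := zlt k; lia].
(* The blocks fill the interval from [y] to [z k], so the exponents add up. *)
have prodQ : (\prod_(i < k) Q i <= z k ^ (z k - y))%N.
  elim: {mlt Qm zk} k => [|k IH]; first by rewrite big_ord0 expn_gt0 (leq_trans y0).
  rewrite big_ord_recr/=.
  have -> : (z k.+1 - y = (z k - y) + (z k.+1 - z k))%N.
    by have := zlt k; have := zy k; lia.
  have z0' : (0 < z k.+1)%N by rewrite (leq_trans y0).
  rewrite expnD leq_mul ?prod_primes_in_le// (leq_trans IH)//.
  by case: (z k - y)%N => // n; rewrite leq_exp2r// ltnW.
(* The run starts at m + 1: block 0 was cut for the defect at 1, and [m] may be 0. *)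
exists m.+1, (z k); split => //.
- by rewrite (leq_trans y1).
- move=> j jk; rewrite addSn -addnS.
  apply: (@defect_abundant R M _ (primes_in (z j) (z j.+1))) => //.
  + by rewrite addnS.
  + exact: primes_in_all.
  + exact: primes_in_uniq.
  + move=> p pin; split; last first.
      by apply: dvdn_trans (Qm j jk); rewrite /Q (big_rem p)//= dvdn_mulr.
    move: pin; rewrite mem_primes_in => /and3P[pp zp _].
    by apply/negP => /(dvdn_leq M0) pM; have := zy j; lia.
  + by rewrite defect_addl//; case: (zP j).
- have zk1 : (1 < z k)%N by rewrite (leq_trans y1).
  have m1 : (m < z k ^ (z k + 1))%N.
    apply: (leq_trans mlt); rewrite addn1 expnS leq_mul ?(leq_trans yM)//.
    by apply: (leq_trans prodQ); rewrite leq_pexp2l ?leq_subr// ltnW.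
  have k1 : (k <= z k ^ (z k + 1))%N.
    rewrite (@leq_trans (z k))//; first by lia.
    by rewrite -{1}(expn1 (z k)) leq_pexp2l//; lia.
  have -> : (z k ^ (z k + 2) = z k * z k ^ (z k + 1))%N by rewrite -expnS addnS.
  apply: (@leq_trans (2 * z k ^ (z k + 1))); first by lia.
  by rewrite leq_mul2r zk1 orbT.
(* The sum over all primes up to [z k] dominates ln ln z(k) - 4, and its part above [y] is at most
   the defects plus k overshoots. *)
have := sum_ln1D_primes_ge R (leq_trans y1 (zy k)); rewrite -/(euler_sum 0 (z k)).
rewrite (@euler_sum_cat y)//.
have : euler_sum y (z k) <= \sum_(1 <= i < 1 + k) defect R M i + k%:R * y%:R^-1.
  elim: {mlt Qm zk prodQ} k => [|k IH].
    by rewrite mul0r addr0 big_geq// z0 /euler_sum big_filter big_geq.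
  rewrite (@euler_sum_cat (z k))//; last exact: ltnW.
  rewrite addnS big_nat_recr//= -natr1 mulrDl mul1r add1n.
  have [_ _] := zP k; move: IH; rewrite add1n; lra.
have le0 : 0 <= L + e / 2 by lra.
have := sum_defect_le 1 k M0 le0 ML.
have : k%:R * y%:R^-1 <= k%:R * (e / 2) by apply: ler_wpM2l.
lra.
Qed.

End Lower.

(** * Passage to the limit, with T the triple logarithm of x *)

Section Limit.
Set Implicit Arguments.
Unset Strict Implicit.
Variable R : realType.
Local Notation L := (ln (varpi R)).

Lemma near_expR3 (B : R) :
  \forall x \near +oo%R, exists2 T : R, B < T & x = expR (expR (expR T)).
Proof.
near=> x; exists (ln (ln (ln x))).
  have x1 : expR (expR (expR B)) < x by near: x; exact: nbhs_pinfty_gt.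
  have x0 : 0 < x by apply: lt_trans x1; exact: expR_gt0.
  have l1 : expR (expR B) < ln x by rewrite -ltr_expR lnK.
  have l0 : 0 < ln x by apply: lt_trans l1; exact: expR_gt0.
  have k1 : expR B < ln (ln x) by rewrite -ltr_expR lnK.
  have k0 : 0 < ln (ln x) by apply: lt_trans k1; exact: expR_gt0.
  by rewrite -ltr_expR lnK.
have x1 : expR (expR 0) < x by near: x; exact: nbhs_pinfty_gt.
have x0 : 0 < x by apply: lt_trans x1; exact: expR_gt0.
have l1 : expR 0 < ln x by rewrite -ltr_expR lnK.
rewrite expR0 in l1.
by rewrite !lnK ?posrE// ?ln_gt0//; apply: lt_trans l1.
Unshelve. all: by end_near. Qed.

Lemma E_upper (c : R) : 0 < c -> 1 < c * L -> exists B : R, forall T, B < T ->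
  (E (expR (expR (expR T))))%:R <= c * T.
Proof.
move=> c0 cL; have L0 := ln_varpi_gt0 R.
(* This solves c (L - e) = 1 + 2 e, leaving a margin e T over the main term (1 + e) T. *)
pose e := (c * L - 1) / (c + 2).
have e0 : 0 < e by rewrite divr_gt0; lra.
have ce : c * (L - e) = 1 + 2 * e by rewrite /e; field; rewrite gt_eqF; lra.
have Le : 0 < L - e by rewrite -(pmulr_rgt0 _ c0); lra.
have [C HC] := abundant_run_upper e0.
(* The bound 4 c yields c T <= (T/2)^2 <= exp T; the last entry makes the margin e T beat the
   constants. *)
pose B := Num.max 1 (Num.max (4 * c) ((2 * (1 + e) + C) / e)).
exists B => T; rewrite !gt_max => /and3P[T1 Tc TC].
rewrite leNgt; apply/negP => cTE.
set x := expR (expR (expR T)) in cTE.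
have [[m m0 run] _] := E_largest x.
(* A run longer than c T is cut to this length, so that the product of its members stays under
   control. *)
pose k := (Num.truncn (c * T)).+1.
have cT0 : 0 <= c * T by rewrite mulr_ge0; lra.
have kE : (k <= E x)%N.
  by rewrite /k -(ltr_nat R); apply: le_lt_trans cTE; rewrite truncn_le.
have k1 : c * T < k%:R by rewrite /k truncnS_gt.
have k2 : k%:R <= c * T + 1 by rewrite /k -natr1 lerD2r truncn_le.
clearbody k.
pose l := expR (expR T); have xE : x = expR l by [].
have T2 : c * T <= expR T.
  have -> : expR T = expR (T / 2) ^+ 2 by rewrite expr2 -expRD; congr expR; lra.
  have := expR_ge1Dx (T / 2); move: (expR _) => v v1.
  apply: (@le_trans _ _ ((T / 2) ^+ 2)); last by rewrite ler_pXn2r// ?nnegrE; lra.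
  have T0 : 0 <= T by lra.
  by have := ler_wpM2l T0 (ltW Tc); rewrite expr2; lra.
have l1 : expR T + 1 <= l by rewrite addrC; exact: expR_ge1Dx.
have l3 : 3 <= l by have := expR_ge1Dx T; lra.
pose u := (Num.truncn (2 * l)).+1.
have u1 : 2 * l < u%:R by rewrite /u truncnS_gt.
have u2 : u%:R <= 2 * l + 1 by rewrite /u -natr1 lerD2r truncn_le; lra.
clearbody u.
have xu : x <= (2 ^ u)%N%:R.
  rewrite natrX xE -[X in _ <= X ^+ _]lnK ?posrE// -expRM_natl ler_expR.
  apply: (@le_trans _ _ (2 * l * (1 / 2))); first by lra.
  by apply: ler_pM; [lra|lra|exact: ltW|exact: ln2_ge].
have u6 : (1 < u)%N by rewrite -(ltr_nat R); lra.
have kp : (0 < k)%N by rewrite -(ltr_nat R); exact: le_lt_trans k1.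
have zP : (1 < u * k)%N by rewrite (leq_trans u6)// leq_pmulr.
have Wz : (\prod_(m <= i < m + k) i <= 2 ^ (u * k))%N.
  rewrite expnM; apply: (@leq_trans (\prod_(m <= i < m + k) 2 ^ u)%N).
    rewrite big_seq [leqRHS]big_seq; apply: leq_prod => i.
    rewrite mem_index_iota => /andP[mi ik].
    rewrite -(ler_nat R); apply: le_trans xu.
    have ij : (i - m < E x)%N by rewrite ltn_subLR// (leq_trans ik)// leq_add2l.
    by have [_] := run _ ij; rewrite subnKC.
  by rewrite prod_nat_const_nat addKn.
have := HC m k (u * k)%N m0 zP _ Wz.
have run' j : (j < k)%N -> abundant (m + j) by move=> jk; case: (run j (leq_trans jk kE)).
move=> /(_ run').
(* From u <= 3 l, k <= l and 3 <= l. Two logarithms then turn the cube into an additive ln 3 <=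
   2. *)
have zl : (u * k)%:R <= l ^+ 3.
  rewrite natrM; apply: (@le_trans _ _ (3 * l * l)).
    by apply: ler_pM; rewrite ?ler0n//; lra.
  by rewrite exprS expr2 mulrA ler_wpM2r//; [lra|rewrite ler_wpM2r//; lra].
have z0 : 0 < (u * k)%:R :> R by rewrite ltr0n ltnW.
have lz0 := @ln_nat_gt0 R _ zP.
have lz : ln (u * k)%:R <= 3 * expR T.
  by rewrite -ler_expR lnK ?posrE// expRM_natl.
have llz : ln (ln (u * k)%:R) <= 2 + T.
  apply: (@le_trans _ _ (ln (3 * expR T))).
    by rewrite ler_ln ?posrE ?mulr_gt0 ?expR_gt0.
  rewrite lnM ?posrE ?expR_gt0// expRK lerD2r.
  have -> : 3 = 1 + 2 :> R by lra.
  by apply: le_ln1Dx; lra.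

have : c * T * (L - e) <= k%:R * (L - e) by rewrite ler_pM2r// ltW.
rewrite mulrAC ce.
have : (1 + e) * ln (ln (u * k)%:R) <= (1 + e) * (2 + T) by rewrite ler_pM2l//; lra.
move: TC; rewrite ltr_pdivrMr//; lra.
Qed.

Lemma E_lower (c : R) : c * L < 1 -> exists B : R, forall T, B < T ->
  c * T <= (E (expR (expR (expR T))))%:R.
Proof.
have [c0 _|c0 cL] := leP c 0.
  exists 0 => T T0; apply: (@le_trans _ _ 0) => //.
  by rewrite mulr_le0_ge0// ltW.
have L0 := ln_varpi_gt0 R.
(* With this choice c (L + e) = 1 - f, and the margin f T absorbs the constants. *)
pose f := (1 - c * L) / 2; have f0 : 0 < f by rewrite /f; lra.
pose e := f / c; have e0 : 0 < e by rewrite divr_gt0.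
have ce : c * (L + e) = 1 - f by rewrite /e /f; field; rewrite gt_eqF.
have [C HC] := abundant_run_lower e0.
exists (Num.max 0 ((L + e + C + 2) / f)) => T; rewrite gt_max => /andP[T0 TC].
set x := expR (expR (expR T)).
pose k := (Num.truncn (c * T)).+1.
have cT0 : 0 <= c * T by rewrite mulr_ge0; lra.
have k1 : c * T < k%:R by rewrite /k truncnS_gt.
have k2 : k%:R <= c * T + 1 by rewrite /k -natr1 lerD2r truncn_le.
clearbody k.
have [m [z [m0 z1 run mz llz]]] := HC k.
have z2 : 2 <= z%:R :> R by rewrite ler_nat.
have z0 : 0 < z%:R :> R by lra.
have lz0 := @ln_nat_gt0 R _ z1.
have llz2 : ln (ln z%:R) <= T - 2.
  apply: (le_trans llz).
  have : k%:R * (L + e) <= (c * T + 1) * (L + e) by apply: ler_wpM2r => //; lra.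
  rewrite mulrDl mul1r mulrAC ce.
  move: TC; rewrite ltr_pdivrMr//; lra.
(* The 2 gained in the bound on ln ln z becomes a factor exp 2 >= 3 here, hence a cube of [z] in the
   next line. *)
have lz : 3 * ln z%:R <= expR T.
  rewrite -[X in _ * X <= _]lnK ?posrE//.
  have -> : expR T = expR 2 * expR (T - 2) by rewrite -expRD; congr expR; lra.
  apply: ler_pM; rewrite ?expR_ge0 ?ler_expR//.
  by have := expR_ge1Dx (2 : R); lra.
have z3 : z%:R ^+ 3 <= expR (expR T).
  by rewrite -[X in X ^+ 3]lnK ?posrE// -expRM_natl ler_expR.
(* The exponent (z + 2) ln z is at most z^2 times z. *)
have zx : (z ^ (z + 2))%N%:R <= x.
  rewrite natrX -[X in X ^+ _]lnK ?posrE// -expRM_natl ler_expR.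
  apply: le_trans z3; rewrite natrD exprSr.
  apply: ler_pM; [lra|exact: ltW| |by rewrite ltW// ln_sublinear].
  by have := ler_wpM2l (ltW z0) z2; rewrite expr2; lra.
apply: (le_trans (ltW k1)); rewrite ler_nat.
apply: (E_largest x).2; exists m => // j jk; split; first exact: run.
by apply: le_trans zx; rewrite ler_nat (leq_trans _ mz)// leq_add2l ltnW.
Qed.
End Limit.

Theorem theorem1 (R : realType) :
  0 < ln (varpi R) /\
  (E x)%:R / ln (ln (ln x)) @[x --> +oo%R] --> (ln (varpi R))^-1.
Proof.
split; first exact: ln_varpi_gt0.
have L0 : 0 < ln (varpi R) := ln_varpi_gt0 R.
apply/cvgrPdist_le => /= e e0.
(* The slopes 1/L + e and 1/L - e, with L = ln [varpi], lie on the two sides of the threshold c L =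
   1. *)
have [|| B1 H1] := @E_upper R ((ln (varpi R))^-1 + e).
- by rewrite addr_gt0// invr_gt0.
- by rewrite mulrDl mulVf ?gt_eqF// ltrDl mulr_gt0.
have [|B2 H2] := @E_lower R ((ln (varpi R))^-1 - e).
  by rewrite mulrBl mulVf ?gt_eqF// gtrBl mulr_gt0.
near=> x.
have [T + xE] : exists2 T : R, Num.max 0 (Num.max B1 B2) < T & x = expR (expR (expR T)).
  by near: x; exact: near_expR3.
rewrite !gt_max => /and3P[T0 /H1 u1 /H2 u2].
rewrite xE !expRK distrC ler_distl; apply/andP; split.
  by rewrite ler_pdivlMr.
by rewrite ler_pdivrMr.
Unshelve. all: by end_near. Qed.
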